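(* Let $X$ be a compact metric space and $f_{0,\infty}=\{f_n\}_{n=0}^\infty$ a sequence of continuous self-maps of $X$. If $(X,f_{0,\infty})$ is Li-Yorke chaotic, then so is $(\mathcal{M}(X),\hat f_{0,\infty})$. If $(X,f_{0,\infty})$ is distributionally chaotic, then so is $(\mathcal{M}(X),\hat f_{0,\infty})$.
   Context: Let $(X,d)$ be a compact metric space. A non-autonomous dynamical system $(X,f_{0,\infty})$ is given by a sequence $f_{0,\infty}=\{f_n\}_{n=0}^\infty$ of continuous self-maps of $X$; write $f_0^n=f_{n-1}\circ\cdots\circ f_0$ for $n\ge1$. $\mathcal{M}(X)$ is the space of all Borel probability measures on $X$ with the Prohorov metric $\mathcal{P}_d(\mu,\nu)=\inf\{\epsilon>0:\mu(A)\le\nu(A^\epsilon)+\epsilon \text{ and } \nu(A)\le\mu(A^\epsilon)+\epsilon \text{ for all Borel } A\subset X\}$, where $A^\epsilon=\{x\in X: d(x,A)<\epsilon\}$; its topology is the weak$^*$-topology and $\mathcal{M}(X)$ is a compact metric space. The induced system $(\mathcal{M}(X),\hat f_{0,\infty})$, $\hat f_{0,\infty}=\{\hat f_n\}_{n=0}^\infty$, consists of the continuous maps $\hat f_n(\mu)(A)=\mu(f_n^{-1}(A))$. $(X,f_{0,\infty})$ is Li-Yorke chaotic if there is an uncountable set $S\subset X$ such that for all $x\ne y$ in $S$: $\liminf_{n\to\infty}d(f_0^n(x),f_0^n(y))=0$ and $\limsup_{n\to\infty}d(f_0^n(x),f_0^n(y))>0$. It is distributionally chaotic if there is an uncountable set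 $D\subset X$ such that for all $x\ne y$ in $D$: (i) $\limsup_{n\to\infty}\frac1n\sum_{i=1}^n\chi_{[0,\epsilon)}(d(f_0^i(x),f_0^i(y)))=1$ for every $\epsilon>0$; and (ii) $\liminf_{n\to\infty}\frac1n\sum_{i=1}^n\chi_{[0,\delta)}(d(f_0^i(x),f_0^i(y)))=0$ for some $\delta>0$. Here $\chi_J$ is the indicator function of $J$. For $\mathcal{M}(X)$ the metric used is $\mathcal{P}_d$. *)

(* Defs.v *)
From HB Require Import structures.
From mathcomp Require Import all_boot all_order all_algebra.
From mathcomp Require Import all_classical all_reals all_analysis.

Set Implicit Arguments.
Unset Strict Implicit.
Unset Printing Implicit Defensive.

Import Order.TTheory GRing.Theory Num.Theory.

Local Open Scope classical_set_scope.
Local Open Scope ring_scope.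

(* [measurableType]s are pointed, hence so are the metric spaces considered
   here. This excludes only the empty space, which has no Borel probability
   measure. *)
#[short(type="pmetricType")]
HB.structure Definition PointedMetric (K : numDomainType) :=
  { M of Metric K M & Pointed M }.

Section chaos.
Context {R : realType} {T : Type}.
Implicit Types (d : T -> T -> R) (f : nat -> T -> T).

(* [orbit_map f n] is f_0^n = f_(n-1) \o ... \o f_0. *)
Fixpoint orbit_map f (n : nat) : T -> T :=
  if n is m.+1 then f m \o orbit_map f m else idfun.

Definition li_yorke_chaotic d f : Prop :=
  exists S : set T, ~ countable S /\
    forall x y, S x -> S y -> x <> y ->
      limn_einf (fun n => (d (orbit_map f n x) (orbit_map f n y))%:E) = 0%E /\
      (0 < limn_esup (fun n => (d (orbit_map f n x) (orbit_map f n y))%:E))%E.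

(* Proportion of the times 1, ..., n at which the orbits of x and y are at
   distance < e; the value 0 at n = 0 is irrelevant for limits. *)
Definition closeness_freq d f (e : R) (x y : T) (n : nat) : R :=
  n%:R^-1 * \sum_(1 <= i < n.+1)
    \1_(`[0, e[%classic) (d (orbit_map f i x) (orbit_map f i y)).

Definition distributionally_chaotic d f : Prop :=
  exists D : set T, ~ countable D /\
    forall x y, D x -> D y -> x <> y ->
      (forall e : R, 0 < e ->
         limn_esup (fun n => (closeness_freq d f e x y n)%:E) = 1%E) /\
      (exists2 e : R, 0 < e &
         limn_einf (fun n => (closeness_freq d f e x y n)%:E) = 0%E).

End chaos.

Section borel_probability.
Context {R : realType} (X : pmetricType R).

Definition borel : measurableType _ := g_sigma_algebraType (@open X).

(* A [probability] is a function on all subsets of X, constrained on Borel sets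
   only. Two of them that agree on Borel sets are at Prohorov distance 0, and so
   are their images under [induced_map]; the chaos conditions thus only ever
   relate measures that differ on some Borel set. *)
Definition borel_probability : Type := probability borel R.

End borel_probability.

Section prohorov.
Context {R : realType} {X : pmetricType R}.

Lemma edist_mdist (x y : X) : edist (x, y) = (mdist x y)%:E.
Proof.
apply/eqP; rewrite eq_le; apply/andP; split.
  apply/lee_addgt0Pr => e e0; rewrite -EFinD; apply: edist_fin.
    by rewrite ltr_wpDl// mdist_ge0.
  by rewrite ballEmdist/= ltrDl.
apply: le_ereal_inf_tmp => _ [r [r0 xyr] <-].
by rewrite lee_fin ltW//; move: xyr; rewrite ballEmdist.
Qed.

(* [edist_inf A x] is d(x, A), with value +oo when A is empty. *)
Definition enlargement (A : set X) (e : R) : set X :=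
  [set x | (edist_inf A x < e%:E)%E].

Definition prohorov (mu nu : borel_probability X) : R :=
  inf [set e : R | 0 < e /\
    forall A : set (borel X), measurable A ->
      (mu A <= nu (enlargement A e) + e%:E)%E /\
      (nu A <= mu (enlargement A e) + e%:E)%E].

End prohorov.

Section induced_system.
Context {R : realType} {X : pmetricType R}.

Lemma continuous_borel_measurable (g : X -> X) :
  continuous g -> measurable_fun [set: borel X] (g : borel X -> borel X).
Proof.
move=> cg.
apply: (@measurability _ _ (borel X) (borel X) _ _ (@open X) erefl).
move=> _ [B oB <-]; rewrite setTI; apply: sub_sigma_algebra.
by move/continuousP : cg; exact.
Qed.

Definition induced_map (g : X -> X) (cg : continuous g)
    (mu : borel_probability X) : borel_probability X :=
  distribution mu (mfun_Sub (mem_set (continuous_borel_measurable cg))).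

Lemma induced_mapE (g : X -> X) (cg : continuous g) mu (A : set X) :
  induced_map cg mu A = mu (g @^-1` A).
Proof. by []. Qed.

Definition induced_system (f : nat -> X -> X) (cf : forall n, continuous (f n)) :
  nat -> borel_probability X -> borel_probability X :=
  fun n => induced_map (cf n).

End induced_system.

(* Main.v *)
(* The map x |-> \d_x embeds the system in the induced one, and the Prohorov
   distance of two Dirac measures is min (d x y) 1. Truncating the metric at 1
   affects neither kind of chaos, because both only involve small distances. *)
Require Import Defs.
From mathcomp Require Import all_boot all_order all_algebra.
From mathcomp Require Import all_classical all_reals all_analysis.

Import Order.TTheory GRing.Theory Num.Theory.

Local Open Scope classical_set_scope.
Local Open Scope ring_scope.

Section limn_esup_einf.
Context {R : realType}.
Implicit Types (u v : (\bar R)^nat) (c : \bar R).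
Local Open Scope ereal_scope.

(** The suprema over tails are nonincreasing, so their limit in the extended reals is their infimum,
    with no boundedness needed. *)
Lemma limn_esup_inf u : limn_esup u = ereal_inf (range (esups u)).
Proof. by rewrite limn_esup_lim; apply/cvg_lim => //; exact: cvg_esups_inf. Qed.

Lemma lt_limn_esup_ex u c : c < limn_esup u ->
  forall n, exists2 m, (n <= m)%N & c < u m.
Proof.
rewrite limn_esup_inf => cu n.
have : c < esups u n.
  by apply: (lt_le_trans cu); apply: ereal_inf_lbound; exists n.
by move=> /ereal_sup_gt[_ [m /= nm <-] cum]; exists m.
Qed.

(** Near-converse of [lt_limn_esup_ex]. Together they carry lower bounds that hold infinitely often
    from one sequence to another when termwise comparison goes the wrong way. *)
Lemma ge_limn_esup_ex u c : (forall n, exists2 m, (n <= m)%N & c <= u m) ->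
  c <= limn_esup u.
Proof.
move=> cu; rewrite limn_esup_inf; apply: le_ereal_inf_tmp => _ [n _ <-].
have [m nm cum] := cu n; apply: (le_trans cum).
by apply: ereal_sup_ubound; exists m.
Qed.

Lemma le_limn_esup u v : (forall n, u n <= v n) -> limn_esup u <= limn_esup v.
Proof.
move=> uv; rewrite !limn_esup_inf.
apply: le_ereal_inf_tmp => _ [n _ <-].
apply: (@le_trans _ _ (esups u n)); first by apply: ereal_inf_lbound; exists n.
apply: ge_ereal_sup => _ [m /= nm <-]; apply: (le_trans (uv m)).
by apply: ereal_sup_ubound; exists m.
Qed.

Lemma le_limn_einf u v : (forall n, u n <= v n) -> limn_einf u <= limn_einf v.
Proof.
(* By definition [limn_einf u] is the opposite of [limn_esup] of [- u]. *)
by move=> uv; rewrite leeN2; apply: le_limn_esup => n; rewrite leeN2.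
Qed.

Lemma limn_esup_cst c : limn_esup (fun=> c) = c.
Proof. by have [] := cvg_limn_einf_sup (@cvg_cst _ c nat \oo _). Qed.

Lemma limn_einf_cst c : limn_einf (fun=> c) = c.
Proof. by have [] := cvg_limn_einf_sup (@cvg_cst _ c nat \oo _). Qed.

End limn_esup_einf.

Section closeness_freq.
Context {R : realType} {T : Type} (d : T -> T -> R) (f : nat -> T -> T).

Lemma closeness_freq_ge0 e x y n : 0 <= closeness_freq d f e x y n.
Proof. by rewrite mulr_ge0 ?invr_ge0// sumr_ge0. Qed.

Lemma closeness_freq_le1 e x y n : closeness_freq d f e x y n <= 1.
Proof.
(* At [n = 0] the convention that 0 has inverse 0 makes the frequency 0. *)
rewrite /closeness_freq; case: n => [|n]; first by rewrite invr0 mul0r.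
rewrite mulrC ler_pdivrMr ?ltr0n// mul1r.
apply: (@le_trans _ _ (\sum_(1 <= i < n.+2) 1)).
  by apply: ler_sum => i _; rewrite indicE lern1 leq_b1.
by rewrite sumr_const_nat subn1.
Qed.

(** The two systems and thresholds are independent, so that the comparison serves both from the base
    system to the induced one (limsup) and back (liminf). *)
Lemma le_closeness_freq e {U : Type} {d' : U -> U -> R} {f' : nat -> U -> U} e'
    x y x' y' n :
  (forall i, 0 <= d (orbit_map f i x) (orbit_map f i y) < e ->
    0 <= d' (orbit_map f' i x') (orbit_map f' i y') < e') ->
  closeness_freq d f e x y n <= closeness_freq d' f' e' x' y' n.
Proof.
move=> dd'; rewrite ler_wpM2l ?invr_ge0// ler_sum// => i _.
rewrite !indicE ler_nat; case: (boolP (_ \in `[0, e[%classic)) => //.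
rewrite inE/= in_itv/= => /dd' dd'i.
by rewrite mem_set//= in_itv.
Qed.

End closeness_freq.

Section truncated_embedding.
Context {R : realType} {T U : Type} (d : T -> T -> R) (d' : U -> U -> R)
  (f : nat -> T -> T) (f' : nat -> U -> U) (h : T -> U).
Hypothesis d_ge0 : forall x y, 0 <= d x y.
Hypothesis h_inj : injective h.
(** An identity between distances, rather than commutation of [h] with the dynamics: images of Dirac
    measures then need only be compared with Dirac measures set by set. *)
Hypothesis d'_orbit : forall n x y,
  d' (orbit_map f' n (h x)) (orbit_map f' n (h y)) =
  Num.min (d (orbit_map f n x) (orbit_map f n y)) 1.

Lemma uncountable_image (S : set T) : ~ countable S -> ~ countable (h @` S).
Proof.
by move=> cS; rewrite (eq_countable (inj_card_eq _))// => x y _ _ /h_inj.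
Qed.

Lemma li_yorke_chaotic_embedding :
  li_yorke_chaotic d f -> li_yorke_chaotic d' f'.
Proof.
move=> [S [cS LY]]; exists (h @` S); split; first exact: uncountable_image.
move=> _ _ [x Sx <-] [y Sy <-] hxy.
have xy : x <> y by move=> xy; apply: hxy; rewrite xy.
have [inf0 sup_gt0] := LY _ _ Sx Sy xy; split.
  apply/eqP; rewrite eq_le; apply/andP; split.
    rewrite -inf0; apply: le_limn_einf => n.
    by rewrite d'_orbit lee_fin ge_min lexx.
  rewrite -[leLHS]limn_einf_cst; apply: le_limn_einf => n.
  by rewrite d'_orbit lee_fin le_min d_ge0 ler01.
(* A real level strictly below the limsup, which may be [+oo]. Distances exceed [c] infinitely
   often, so truncated ones are at least [min c 1] infinitely often. *)
have [c c_gt0 csup] : exists2 c : R, 0 < c &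
    (c%:E < limn_esup (fun n =>
      (d (orbit_map f n x) (orbit_map f n y))%:E))%E.
  move: sup_gt0; case: limn_esup => [r| |]//.
  - rewrite lte_fin => r0; exists (r / 2); first exact: divr_gt0.
    by rewrite lte_fin; rewrite gtr_pMr// invf_lt1// ltr1n.
  - by move=> _; exists 1 => //; rewrite ltry.
apply: (@lt_le_trans _ _ (Num.min c 1)%:E).
  by rewrite lte_fin lt_min c_gt0 ltr01.
apply: ge_limn_esup_ex => n.
have [m nm cm] := lt_limn_esup_ex _ _ csup n; exists m => //.
by rewrite d'_orbit lee_fin le_min !ge_min lexx orbT andbT ltW.
Qed.

Lemma distributionally_chaotic_embedding :
  distributionally_chaotic d f -> distributionally_chaotic d' f'.
Proof.
move=> [S [cS DC]]; exists (h @` S); split; first exact: uncountable_image.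
move=> _ _ [x Sx <-] [y Sy <-] hxy.
have xy : x <> y by move=> xy; apply: hxy; rewrite xy.
have [sup1 [e e_gt0 inf0]] := DC _ _ Sx Sy xy; split.
  move=> a a_gt0; apply/eqP; rewrite eq_le; apply/andP; split.
    rewrite -[leRHS]limn_esup_cst; apply: le_limn_esup => n.
    by rewrite lee_fin closeness_freq_le1.
  (* Truncation lowers distances, so closeness at scale [a] persists. *)
  rewrite -(sup1 _ a_gt0); apply: le_limn_esup => n; rewrite lee_fin.
  apply: le_closeness_freq => i /andP[_ da].
  by rewrite d'_orbit le_min d_ge0 ler01 gt_min da.
(* Below 1 truncation changes nothing: a truncated distance less than [min e 1] is the original
   distance, hence less than [e]. *)
exists (Num.min e 1); first by rewrite lt_min e_gt0 ltr01.
apply/eqP; rewrite eq_le; apply/andP; split.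
  rewrite -inf0; apply: le_limn_einf => n; rewrite lee_fin.
  apply: le_closeness_freq => i.
  rewrite d'_orbit d_ge0 lt_min !gt_min ltxx orbF => /andP[_ /andP[+ d1]].
  by move=> /orP[//|]; exact: lt_trans.
rewrite -[leLHS]limn_einf_cst; apply: le_limn_einf => n.
by rewrite lee_fin closeness_freq_ge0.
Qed.

End truncated_embedding.

Section dirac_embedding.
Context {R : realType} {X : pmetricType R}.

Definition dirac_probability (x : X) : borel_probability X :=
  \d_(x : borel X).

Lemma measurable_borel_set1 (x : X) : measurable ([set x] : set (borel X)).
Proof.
have cx : closed [set x].
  by apply: accessible_closed_set1; apply: hausdorff_accessible;
     exact: metric_hausdorff.
rewrite -[X in measurable X]setCK; apply: measurableC.
by apply: sub_sigma_algebra; exact: closed_openC.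
Qed.

Lemma dirac_probability_inj : injective dirac_probability.
Proof.
move=> x y xy.
have : dirac_probability x [set x] = dirac_probability y [set x] by rewrite xy.
rewrite /= !diracE mem_set// => -[] /eqP.
by rewrite eqr_nat eq_sym eqb1 inE => ->.
Qed.

Lemma enlargement_set1 (x y : X) e : enlargement [set x] e y = (mdist x y < e).
Proof.
by rewrite /enlargement/= /edist_inf image_set1 ereal_inf1 edist_mdist lte_fin
  metric_sym.
Qed.

Lemma mem_enlargement (A : set X) (x y : X) e : A x -> mdist x y < e ->
  enlargement A e y.
Proof.
move=> Ax xye; apply: (@le_lt_trans _ _ (mdist x y)%:E); last by rewrite lte_fin.
by apply: ereal_inf_lbound; exists x => //; rewrite edist_mdist metric_sym.
Qed.

(** The admissible radii [E] lie between the open and the closed half-line starting at the claimed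
    value, which determines their infimum. *)
Lemma prohorov_dirac (mu nu : borel_probability X) (x y : X) :
  (forall A, mu A = dirac_probability x A) ->
  (forall A, nu A = dirac_probability y A) ->
  prohorov mu nu = Num.min (mdist x y) 1.
Proof.
move=> mux nuy; rewrite /prohorov; set E := [set e | _].
have dirac_le (z t : X) (A : set (borel X)) e : 0 < e ->
    Num.min (mdist z t) 1 < e ->
    (dirac_probability z A <= dirac_probability t (enlargement A e) + e%:E)%E.
  move=> e0 zte; rewrite /= !diracE -EFinD lee_fin.
  have [/set_mem Az|_] := boolP (z \in A); last by rewrite addr_ge0// ltW.
  (* Either [t] lies in the enlargement of [A], or [e] alone dominates the total mass 1. *)
  move: zte; rewrite gt_min => /orP[zte|/ltW e1].
    by rewrite (mem_set (mem_enlargement _ _ _ _ Az zte)) lerDl ltW.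
  by rewrite (le_trans e1)// lerDr.
have Emin e : Num.min (mdist x y) 1 < e -> E e.
  move=> xye; have e0 : 0 < e by rewrite (le_lt_trans _ xye)// le_min mdist_ge0/=.
  split => // A _; rewrite mux nuy mux nuy; split; first exact: dirac_le.
  by apply: dirac_le => //; rewrite metric_sym.
have minE e : E e -> Num.min (mdist x y) 1 <= e.
  (* Test on the singleton of [x]: unless [y] is within [e] of [x], the inequality reads
     [1 <= 0 + e]. *)
  move=> [e0 /(_ _ (measurable_borel_set1 x))[+ _]]; rewrite mux nuy /= !diracE.
  rewrite mem_set// -EFinD lee_fin ge_min.
  have [|_] := boolP (y \in _); last by rewrite add0r => ->; rewrite orbT.
  by rewrite inE enlargement_set1 => /ltW ->.
apply/eqP; rewrite eq_le; apply/andP; split.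
  (* The slack [e] is needed because the minimum may lie outside [E], as it does when [x = y]. *)
  apply/ler_addgt0Pr => e e0; apply: ge_inf.
    by exists 0 => z [/ltW].
  by apply: Emin; rewrite ltrDl.
apply: lb_le_inf; last by move=> e /minE.
by exists (Num.min (mdist x y) 1 + 1); apply: Emin; rewrite ltrDl.
Qed.

Lemma orbit_map_dirac (f : nat -> X -> X) (cf : forall n, continuous (f n))
    n (x : X) (A : set X) :
  orbit_map (induced_system cf) n (dirac_probability x) A =
  dirac_probability (orbit_map f n x) A.
Proof.
(* [A] is generalized because the induction hypothesis is applied to the preimage of [A] under
   [f n]. *)
elim: n A => [//|n IH] A.
by rewrite /= /induced_system induced_mapE IH /= !diracE.
Qed.

End dirac_embedding.

Theorem proposition5p5 (R : realType) (X : pmetricType R)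
    (cX : compact [set: X])
    (f : nat -> X -> X) (cf : forall n, continuous (f n)) :
  (li_yorke_chaotic (@mdist R X) f ->
     li_yorke_chaotic (@prohorov R X) (induced_system cf)) /\
  (distributionally_chaotic (@mdist R X) f ->
     distributionally_chaotic (@prohorov R X) (induced_system cf)).
Proof.
have dist_orbit n (x y : X) :
    prohorov (orbit_map (induced_system cf) n (dirac_probability x))
             (orbit_map (induced_system cf) n (dirac_probability y)) =
    Num.min (mdist (orbit_map f n x) (orbit_map f n y)) 1.
  by apply: prohorov_dirac => A; exact: orbit_map_dirac.
split.
- by apply: li_yorke_chaotic_embedding (@mdist_ge0 _ _) _ dist_orbit;
     exact: dirac_probability_inj.
- by apply: distributionally_chaotic_embedding (@mdist_ge0 _ _) _ dist_orbit;
     exact: dirac_probability_inj.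
Qed.
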